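(* Let $N\ge 1$ and let $P$ and $P'$ be two finite graded prefixes through rank $N$ that agree through rank $N-1$ (that is, their subposets of elements of rank at most $N-1$ are the same) and differ only in their rank-$N$ extensions. Let $p_N$ and $p_N'$ be the numbers of elements of rank $N$ in $P$ and $P'$ respectively, and put $\delta=p_N'-p_N$. Then $$[q^i]Q_{P'}=[q^i]Q_P\quad\text{for all } i<N,$$ and $$[q^N]Q_{P'}-[q^N]Q_P=-\delta.$$
   Context: A graded prefix through rank $N$ is a finite graded poset $P=\bigsqcup_{n=0}^{N}P_n$ with least element $\widehat 0$ (so $P_0=\{\widehat 0\}$) and rank function $\rho$, where $P_n=\{x:\rho(x)=n\}$ and covering relations raise rank by exactly one. Put $p_n=|P_n|$. Define $$F_P(q)=\sum_{n}p_nq^n,\qquad M_{P,2}(q)=\sum_{\widehat 0\le x_1\le x_2}q^{\rho(x_1)+\rho(x_2)},$$ the second sum being over all pairs $(x_1,x_2)$ of elements of $P$ with $x_1\le x_2$. Both $M_{P,2}(q)$ and $F_P(q)^2$ have integer coefficients and constant term $1$; define $$Q_P(q)=\frac{M_{P,2}(q)}{F_P(q)^2}\in\mathbb{Z}[[q]].$$ $[q^i]S$ denotes the coefficient of $q^i$ in the power series $S$. *)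

(* Defs.v *)
From HB Require Import structures.
From mathcomp Require Import all_boot all_order all_algebra.

Set Implicit Arguments.
Unset Strict Implicit.
Unset Printing Implicit Defensive.

Import Order.TTheory GRing.Theory Num.Theory.
Local Open Scope ring_scope.

(* A formal power series over R is its coefficient function. *)
Definition fps (R : Type) := nat -> R.

Definition fps_of_poly (R : nzRingType) (p : {poly R}) : fps R := fun n => p`_n.

Section FpsQuotient.
Variable R : comUnitRingType.
Implicit Types f g : fps R.

(* Long division: the quotient h of f by g has coefficients
   h_n = g_0^-1 * (f_n - \sum_(i < n) h_i * g_(n - i)),
   and fps_quo_coefs f g n lists h_0, ..., h_(n-1). *)
Fixpoint fps_quo_coefs f g (n : nat) : seq R :=
  if n is m.+1 then
    let h := fps_quo_coefs f g m in
    rcons h ((g 0%N)^-1 * (f m - \sum_(i < m) h`_i * g (m - i)%N))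
  else [::].

Definition fps_quo f g : fps R := fun n => (fps_quo_coefs f g n.+1)`_n.

Lemma size_fps_quo_coefs f g n : size (fps_quo_coefs f g n) = n.
Proof. by elim: n => //= n IHn; rewrite size_rcons IHn. Qed.

Lemma nth_fps_quo_coefs f g n i :
  (i < n)%N -> (fps_quo_coefs f g n)`_i = fps_quo f g i.
Proof.
elim: n => // n IHn; rewrite ltnS leq_eqVlt => /orP[/eqP -> // | lt_in].
by rewrite /= nth_rcons size_fps_quo_coefs lt_in IHn.
Qed.

Lemma fps_quoE f g n :
  fps_quo f g n =
    (g 0%N)^-1 * (f n - \sum_(i < n) fps_quo f g i * g (n - i)%N).
Proof.
rewrite {1}/fps_quo /= nth_rcons size_fps_quo_coefs ltnn eqxx.
by congr (_ * (_ - _)); apply: eq_bigr => i _; rewrite nth_fps_quo_coefs.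
Qed.

(* When g_0 is a unit, the Cauchy product of fps_quo f g and g is f. *)
Lemma fps_quoK f g n : g 0%N \is a GRing.unit ->
  \sum_(i < n.+1) fps_quo f g i * g (n - i)%N = f n.
Proof.
move=> g0U; rewrite big_ord_recr /= subnn fps_quoE.
by rewrite mulrC mulVKr // addrC subrK.
Qed.

End FpsQuotient.

Section GradedPrefix.
Variables (d : Order.disp_t) (P : finBPOrderType d).

Definition covers (x y : P) : Prop :=
  (x < y)%O /\ forall z : P, ~ ((x < z)%O /\ (z < y)%O).

(* The levels P_n with 0 < n <= N are allowed to be empty. *)
Record graded_prefix (N : nat) (rho : P -> nat) : Prop := GradedPrefix {
  rank_le : forall x : P, (rho x <= N)%N;
  rank_eq0 : forall x : P, rho x = 0%N <-> x = \bot%O;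
  rank_covers : forall x y : P, covers x y -> rho y = (rho x).+1
}.

Variable rho : P -> nat.

Definition rank_level (n : nat) : {set P} := [set x | rho x == n].

Definition level_card (n : nat) : nat := #|rank_level n|.

(* The sum stops at N since the levels above N are empty. *)
Definition rank_gf (N : nat) : {poly int} :=
  \sum_(n < N.+1) (level_card n)%:R *: 'X^n.

Definition multichain2_gf : {poly int} :=
  \sum_(x1 : P) \sum_(x2 : P | (x1 <= x2)%O) 'X^(rho x1 + rho x2).

Definition multichain2_quo (N : nat) : fps int :=
  fps_quo (fps_of_poly multichain2_gf) (fps_of_poly (rank_gf N ^+ 2)).

Definition truncation (m : nat) : Type := {x : P | (rho x <= m)%N}.

End GradedPrefix.

(* The truncations are the same poset up to relabelling of the elements, i.e.,
   isomorphic; between graded prefixes, an isomorphism preserves the ranks. *)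
Definition agree_through (m : nat)
    (d : Order.disp_t) (P : finBPOrderType d) (rho : P -> nat)
    (d' : Order.disp_t) (P' : finBPOrderType d') (rho' : P' -> nat) : Prop :=
  exists2 f : truncation rho m -> truncation rho' m,
    bijective f &
    forall x y, (val (f x) <= val (f y))%O = (val x <= val y)%O.

(* Main.v *)
Require Import Defs.
From mathcomp Require Import all_boot all_order all_algebra.
From mathcomp Require Import ring.

Set Implicit Arguments.
Unset Strict Implicit.
Unset Printing Implicit Defensive.

Import Order.TTheory GRing.Theory Num.Theory.
Local Open Scope ring_scope.

(** Write M and F for the two generating functions. Their coefficients below N
involve ranks below N only, and ranks below N can be read off the order of the
truncation (a nonbottom element has rank one more than any of its lower
covers), so these coefficients, and hence those of Q, are the same for P and
P'. In degree N, a pair x1 <= x2 whose ranks add up to N and that contains an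
element of rank N must be (bottom, x2): the other element has rank 0, and an
element of rank N > 0 is not below bottom. So M gains exactly delta, while F^2
gains 2 * delta because the constant term of F is 1. Long division turns this
into the gain delta - [q^0]Q * (2 * delta) = - delta, since [q^0]Q = 1
([multichain2_gf_coef], [rank_gf_sqr_coefN] and [fps_quo_perturb]). *)

(** * Perturbing a quotient of power series in one degree *)

Lemma eq_fps_quo (R : comUnitRingType) (f g f' g' : fps R) n :
  (forall i, (i <= n)%N -> f' i = f i) -> (forall i, (i <= n)%N -> g' i = g i) ->
  fps_quo f' g' n = fps_quo f g n.
Proof.
elim/ltn_ind: n => n IHn eqf eqg.
rewrite !fps_quoE eqf // eqg //; congr (_ * (_ - _)).
apply: eq_bigr => i _; rewrite eqg ?leq_subr // IHn // => j le_ji.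
- by apply: eqf; exact: leq_trans le_ji (ltnW (ltn_ord i)).
- by apply: eqg; exact: leq_trans le_ji (ltnW (ltn_ord i)).
Qed.

(** In the recurrence for the quotient, the top coefficient of the divisor
meets only the constant term of the quotient. *)
Lemma fps_quo_perturb (R : comUnitRingType) (f g f' g' : fps R) n :
  (forall i, (i <= n)%N -> f' i = f i) -> (forall i, (i <= n)%N -> g' i = g i) ->
  g 0%N = 1 ->
  fps_quo f' g' n.+1 - fps_quo f g n.+1 =
    (f' n.+1 - f n.+1) - f 0%N * (g' n.+1 - g n.+1).
Proof.
move=> eqf eqg g0.
have quo0 : fps_quo f g 0 = f 0%N.
  by rewrite fps_quoE big_ord0 subr0 g0 invr1 mul1r.
have eqh i : (i <= n)%N -> fps_quo f' g' i = fps_quo f g i.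
  by move=> le_in; apply: eq_fps_quo => j le_ji;
     [apply: eqf | apply: eqg]; exact: leq_trans le_ji le_in.
rewrite !(fps_quoE _ _ n.+1) eqg // g0 invr1 !mul1r !big_ord_recl /= !subn0.
rewrite eqh // quo0.
set s' := \sum_(i < n) _; set s := \sum_(i < n) _.
have -> : s' = s.
  apply: eq_bigr => i _; rewrite eqh ?[bump 0 i]add1n //.
  by rewrite subSS eqg // leq_subr.
ring.
Qed.

(** * Ranks in a graded prefix *)

Section Rank.
Variables (d : Order.disp_t) (P : finBPOrderType d).
Variables (N : nat) (rho : P -> nat).
Hypothesis rhoP : graded_prefix N rho.

Lemma rank_bot : rho \bot%O = 0%N.
Proof. by apply/(rank_eq0 rhoP). Qed.

(** Among the elements of the interval from x to y that are strictly below y,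
one with the most elements strictly below it is maximal. *)
Lemma exists_lower_cover (x y : P) :
  (x < y)%O -> exists2 w, (x <= w)%O & covers w y.
Proof.
move=> lt_xy; pose below w := #|[set z : P | (z < w)%O]|.
have x_ok : (x <= x)%O && (x < y)%O by rewrite lexx.
case: (@arg_maxnP _ x (fun w => (x <= w) && (w < y))%O below x_ok).
move=> w /andP[le_xw lt_wy] w_max; exists w => //; split=> // z [lt_wz lt_zy].
have := w_max z; rewrite lt_zy (le_trans le_xw (ltW lt_wz)) => /(_ isT).
apply/negP; rewrite -ltnNge; apply/proper_card/properP.
split; last by exists w; rewrite !inE ?ltxx.
by apply/subsetP => v; rewrite !inE => /lt_trans; apply.
Qed.

(** Induction on the rank of y: if x < y, some lower cover of y, whose rank is
one less, still lies above x. *)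
Lemma rank_homo (x y : P) : (x <= y)%O -> (rho x <= rho y)%N.
Proof.
have [n] := ubnP (rho y); elim: n y => // n IHn y lt_yn.
rewrite le_eqVlt => /predU1P[-> // | /exists_lower_cover[w le_xw cov_wy]].
rewrite (rank_covers rhoP cov_wy) in lt_yn *.
by apply: leqW; exact: IHn.
Qed.

Lemma level_card0 : level_card rho 0 = 1%N.
Proof.
rewrite /level_card -(cards1 (\bot%O : P)); apply: eq_card => x.
by rewrite !inE; apply/eqP/eqP => /(rank_eq0 rhoP).
Qed.

End Rank.

(** * Transport along an isomorphism of truncations *)

Section Transport.
Variables (d : Order.disp_t) (P : finBPOrderType d) (rho : P -> nat).
Variables (d' : Order.disp_t) (P' : finBPOrderType d') (rho' : P' -> nat).
Variables (N m : nat) (f : truncation rho m -> truncation rho' m).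
Hypotheses (rhoP : graded_prefix N rho) (rhoP' : graded_prefix N rho').
Hypothesis f_bij : bijective f.
Hypothesis f_mono : forall x y, (val (f x) <= val (f y))%O = (val x <= val y)%O.

Lemma truncation_iso_bot u : val u = \bot%O -> val (f u) = \bot%O.
Proof.
move=> u_bot; have [g _ gK] := f_bij.
have bot_m : (rho' \bot%O <= m)%N by rewrite (rank_bot rhoP').
pose b : truncation rho' m := exist (fun x => rho' x <= m)%N _ bot_m.
have fgb : val (f (g b)) = \bot%O by rewrite gK.
by apply/eqP; rewrite -lex0 -[X in (_ <= X)%O]fgb f_mono u_bot le0x.
Qed.

Lemma truncation_iso_lt u v : (val (f u) < val (f v))%O = (val u < val v)%O.
Proof. by rewrite !lt_leAnge !f_mono. Qed.

(** A truncation is closed downwards because ranks are monotone, so an element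
strictly between f u and f v would come from one strictly between u and v. *)
Lemma truncation_iso_covers u v :
  covers (val u) (val v) -> covers (val (f u)) (val (f v)).
Proof.
move=> [lt_uv no_mid]; split=> [|z [lt_uz lt_zv]].
  by rewrite truncation_iso_lt.
have z_m : (rho' z <= m)%N.
  exact: leq_trans (rank_homo rhoP' (ltW lt_zv)) (valP (f v)).
have [g _ gK] := f_bij; pose w := g (exist (fun x => rho' x <= m)%N z z_m).
have fw : z = val (f w) by rewrite gK.
by apply: (no_mid (val w)); rewrite -!truncation_iso_lt -fw.
Qed.

(** Ranks are determined by the order of the truncation: going down along lower
covers decreases the rank by one at each step until bottom is reached. *)
Lemma truncation_iso_rank u : rho' (val (f u)) = rho (val u).
Proof.
have [n] := ubnP (rho (val u)); elim: n u => // n IHn u lt_un.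
have [u_bot | u_nbot] := eqVneq (val u) \bot%O.
  by rewrite truncation_iso_bot // u_bot (rank_bot rhoP) (rank_bot rhoP').
have [|w _ cov_wu] := @exists_lower_cover _ P \bot%O (val u).
  by rewrite lt0x.
have rk_u := rank_covers rhoP cov_wu.
have w_m : (rho w <= m)%N.
  by apply: leq_trans (valP u); rewrite rk_u.
pose v : truncation rho m := exist (fun x => rho x <= m)%N w w_m.
rewrite rk_u (rank_covers rhoP' (@truncation_iso_covers v u cov_wu)) IHn //.
by rewrite rk_u in lt_un.
Qed.

Lemma sum_truncation_iso (R : nmodType) (E : P -> R) (E' : P' -> R) :
  (forall u, E' (val (f u)) = E (val u)) ->
  \sum_(x | (rho' x <= m)%N) E' x = \sum_(x | (rho x <= m)%N) E x.
Proof.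
move=> eqE.
rewrite (big_sub [pred x | (rho' x <= m)%N]) (big_sub [pred x | (rho x <= m)%N]).
by rewrite (reindex f) /=; [apply: eq_bigr => u _; exact: eqE | exact: onW_bij].
Qed.

Lemma level_card_truncation_iso n :
  (n <= m)%N -> level_card rho' n = level_card rho n.
Proof.
move=> le_nm.
have cardE e (Q : finBPOrderType e) (r : Q -> nat) :
    level_card r n = (\sum_(x | (r x <= m)%N) (r x == n))%N.
  rewrite /level_card -sum1_card big_mkcond [RHS]big_mkcond.
  apply: eq_bigr => x _; rewrite inE.
  by case: eqP => [-> | _]; rewrite ?le_nm // if_same.
rewrite !cardE; apply: (@sum_truncation_iso nat) => u.
by rewrite truncation_iso_rank.
Qed.

End Transport.

(** * The coefficients of the two generating functions *)

(** An iterated sum of indicators rather than a cardinal, so that two uses of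
[sum_truncation_iso] transport it along an isomorphism. *)
Definition truncated_pairs (d : Order.disp_t) (P : finBPOrderType d)
    (rho : P -> nat) (m i : nat) : int :=
  \sum_(x | (rho x <= m)%N) \sum_(y | (rho y <= m)%N)
    ((x <= y)%O && (rho x + rho y == i)%N)%:R.

Section Coefficients.
Variables (d : Order.disp_t) (P : finBPOrderType d) (rho : P -> nat) (m : nat).
Hypothesis rhoP : graded_prefix m.+1 rho.

Lemma rank_top (x : P) : ~~ (rho x <= m)%N = (rho x == m.+1).
Proof. by rewrite -ltnNge eqn_leq (rank_le rhoP). Qed.

(** A pair x <= y with ranks adding up to at most [m.+1] is missed by
[truncated_pairs] only if x is bottom and y has rank [m.+1]. *)
Lemma multichain2_gf_coef i : (i <= m.+1)%N ->
  (multichain2_gf rho)`_i =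
    truncated_pairs rho m i + (level_card rho m.+1)%:R *+ (i == m.+1).
Proof.
move=> le_im.
transitivity (\sum_(x : P) \sum_(y : P)
    ((x <= y)%O && (rho x + rho y == i)%N)%:R : int).
  rewrite coef_sum; apply: eq_bigr => x _; rewrite coef_sum big_mkcond.
  by apply: eq_bigr => y _; rewrite coefXn eq_sym; case: (x <= y)%O.
rewrite (bigID (fun x => rho x <= m)%N) /= [X in _ + X]big1 => [|x]; last first.
  rewrite rank_top => /eqP rk_x; apply: big1 => y _.
  case: (boolP (x <= y)%O) => //= /(rank_homo rhoP); rewrite rk_x => lt_my.
  (* Both ranks are m.+1, and their sum exceeds i. *)
  case: eqP => // def_i; move: le_im; rewrite -def_i leqNgt -addn1 leq_add //.
  exact: leq_trans lt_my.
rewrite addr0 (eq_bigr _ (fun x _ => bigID (fun y => rho y <= m)%N _ _)) /=.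
rewrite big_split /=; congr (_ + _).
rewrite (bigD1 \bot%O) ?(rank_bot rhoP) //= [X in _ + X]big1 => [|x].
  rewrite addr0 /level_card -sum1_card natr_sum -sumrMnl.
  apply: eq_big => [y | y]; first by rewrite inE rank_top.
  by rewrite rank_top => /eqP ->; rewrite le0x eq_sym.
move=> /andP[_ x_nbot]; apply: big1 => y; rewrite rank_top => /eqP ->.
have rk_x : (0 < rho x)%N.
  by rewrite lt0n; apply: contra x_nbot => /eqP/(rank_eq0 rhoP)/eqP.
case: eqP => [def_i | _]; last by rewrite andbF.
by move: le_im; rewrite -def_i leqNgt -[X in (X < _)%N]add0n ltn_add2r rk_x.
Qed.

Lemma truncated_pairs0 : truncated_pairs rho m 0 = 1.
Proof.
have rk_gt0 x : x != \bot%O -> (rho x == 0)%N = false.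
  by move=> x_nbot; apply: contraNF x_nbot => /eqP/(rank_eq0 rhoP)/eqP.
rewrite /truncated_pairs (bigD1 \bot%O) ?(rank_bot rhoP) //=.
rewrite (bigD1 \bot%O) ?(rank_bot rhoP) //= lexx big1 => [|y /andP[_ y_nbot]].
  rewrite addr0 big1 ?addr0 // => x /andP[_ x_nbot]; apply: big1 => y _.
  by rewrite addn_eq0 rk_gt0 // andbF.
by rewrite rk_gt0 // andbF.
Qed.

Lemma rank_gf_coef n :
  (n <= m.+1)%N -> (rank_gf rho m.+1)`_n = (level_card rho n)%:R.
Proof.
move=> le_nm.
have -> : rank_gf rho m.+1 = \poly_(j < m.+2) (level_card rho j)%:R.
  by rewrite poly_def.
by rewrite coef_poly ltnS le_nm.
Qed.

Lemma rank_gf_sqr_coef n : (n <= m.+1)%N ->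
  (rank_gf rho m.+1 ^+ 2)`_n =
    \sum_(j < n.+1) (level_card rho j)%:R * (level_card rho (n - j))%:R.
Proof.
move=> le_nm; rewrite expr2 coefM; apply: eq_bigr => j _.
rewrite !rank_gf_coef //; first by rewrite (leq_trans (leq_subr _ _)).
by rewrite (leq_trans _ le_nm) // -ltnS.
Qed.

(** The top level is paired with the constant term 1, once in each order. *)
Lemma rank_gf_sqr_coefN :
  (rank_gf rho m.+1 ^+ 2)`_m.+1 =
    (level_card rho m.+1)%:R *+ 2 +
    \sum_(j < m) (level_card rho j.+1)%:R * (level_card rho (m - j))%:R.
Proof.
rewrite rank_gf_sqr_coef // big_ord_recl big_ord_recr /= [bump 0 m]add1n.
rewrite subnn subn0 (level_card0 rhoP) mul1r mulr1 mulr2n -addrA.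
by congr (_ + _); rewrite addrC.
Qed.

End Coefficients.

Theorem lemma3p1 (N : nat) (hN : (1 <= N)%N)
    (d : Order.disp_t) (P : finBPOrderType d) (rho : P -> nat)
    (d' : Order.disp_t) (P' : finBPOrderType d') (rho' : P' -> nat)
    (hP : graded_prefix N rho) (hP' : graded_prefix N rho')
    (hagree : agree_through (N - 1) rho rho') :
  let delta : int := (level_card rho' N)%:Z - (level_card rho N)%:Z in
  (forall i : nat, (i < N)%N ->
     multichain2_quo rho' N i = multichain2_quo rho N i) /\
  multichain2_quo rho' N N - multichain2_quo rho N N = - delta.
Proof.
case: N hN hP hP' hagree => // m _ hP hP'; rewrite subn1 /= => -[f f_bij f_mono].
have rank_f u : rho' (val (f u)) = rho (val u).
  exact: (truncation_iso_rank hP hP' f_bij f_mono).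
have eq_level n : (n <= m)%N -> level_card rho' n = level_card rho n.
  exact: (level_card_truncation_iso hP hP' f_bij f_mono).
have eq_pairs i : truncated_pairs rho' m i = truncated_pairs rho m i.
  apply: (sum_truncation_iso f_bij) => u; apply: (sum_truncation_iso f_bij) => v.
  by rewrite f_mono !rank_f.
have eqM i : (i <= m)%N -> fps_of_poly (multichain2_gf rho') i =
                           fps_of_poly (multichain2_gf rho) i.
  move=> le_im; rewrite /fps_of_poly.
  rewrite (multichain2_gf_coef hP) ?(multichain2_gf_coef hP') ?leqW //.
  by rewrite eq_pairs [i == _]ltn_eqF.
have eqG i : (i <= m)%N -> fps_of_poly (rank_gf rho' m.+1 ^+ 2) i =
                           fps_of_poly (rank_gf rho m.+1 ^+ 2) i.
  move=> le_im; rewrite /fps_of_poly !rank_gf_sqr_coef ?leqW //.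
  apply: eq_bigr => j _; have le_ji : (j <= i)%N by rewrite -ltnS.
  rewrite !eq_level //; last exact: leq_trans le_im.
  exact: leq_trans (leq_subr _ _) le_im.
have G0 : fps_of_poly (rank_gf rho m.+1 ^+ 2) 0 = 1.
  rewrite /fps_of_poly rank_gf_sqr_coef // big_ord1.
  by rewrite subn0 (level_card0 hP) mulr1.
have M0 : fps_of_poly (multichain2_gf rho) 0 = 1.
  by rewrite /fps_of_poly (multichain2_gf_coef hP) // (truncated_pairs0 hP) addr0.
split=> [i lt_im|].
  by apply: eq_fps_quo => j le_ji; [apply: eqM | apply: eqG];
     exact: leq_trans le_ji lt_im.
rewrite /multichain2_quo (fps_quo_perturb eqM eqG G0) M0 mul1r /fps_of_poly.
rewrite (multichain2_gf_coef hP) // (multichain2_gf_coef hP') // eq_pairs eqxx.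
rewrite (rank_gf_sqr_coefN hP) (rank_gf_sqr_coefN hP') !mulr1n.
set s' := \sum_(j < m) _; set s := \sum_(j < m) _.
have -> : s' = s.
  by apply: eq_bigr => j _; rewrite !eq_level ?leq_subr // ltn_ord.
rewrite -!natz; ring.
Qed.
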